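(* Let $p$ be a prime, $G$ a finite $p$-group, $\mathbf{F}$ a field of characteristic $p$, and $V$ an $\mathbf{F}G$-module of finite dimension $n$. Choose a basis $\{x,y_1,\ldots,y_{n-1}\}$ of $V^*$ such that $x\in (V^* )^G$ and, for each $i$, the orbit $y_iG$ is contained in $\mathrm{Span}_{\mathbf{F}}\{x,y_j\mid j\le i\}$, and use the graded reverse lexicographic order on $\mathbf{F}[V]=\mathbf{F}[x,y_1,\ldots,y_{n-1}]$ with $x<y_1<\cdots<y_{n-1}$. Let $\mathcal{B}=\{x,f_1,\ldots,f_\ell\}$, where $f_1,\ldots,f_\ell\in\mathbf{F}[V]^G$ are homogeneous with $\mathrm{LM}(f_i)\in\mathbf{F}[y_1,\ldots,y_{n-1}]$, and let $A$ be the $\mathbf{F}$-algebra generated by $\mathcal{B}$. Suppose that $A[x^{-1}]=\mathbf{F}[V]^G[x^{-1}]$ and that there exist $h_1,\ldots,h_{n-1}\in\mathcal{B}$ such that $\mathrm{LM}(h_i)=y_i^{a_i}$ for positive integers $a_i$. Then the SAGBI/Divide-by-$x$ algorithm applied to $\mathcal{B}$ terminates with a SAGBI basis for $\mathbf{F}[V]^G$.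
   Context: $V$ is a left $\mathbf{F}G$-module, $V^*$ is the dual right module, $\mathbf{F}[V]$ is the symmetric algebra on $V^*$ with $G$ acting by degree-preserving algebra automorphisms, and $\mathbf{F}[V]^G$ is the subring of invariants. $\mathrm{LM}(f)$ and $\mathrm{LT}(f)$ denote the lead monomial and lead term of $f$. A subset $\mathcal{B}$ of a subalgebra $A$ of a polynomial ring is a SAGBI basis for $A$ if the lead monomials of the elements of $\mathcal{B}$ generate, as an algebra, the lead term algebra of $A$ (the algebra spanned by the lead monomials of the nonzero elements of $A$). For $\mathcal{B}=\{f_1,\ldots,f_m\}$ and a sequence $I=(i_1,\ldots,i_m)$ of non-negative integers write $f^I=\prod_j f_j^{i_j}$. A tête-à-tête for $\mathcal{B}$ is a pair $(f^I,f^J)$ with $\mathrm{LM}(f^I)=\mathrm{LM}(f^J)$; it is non-trivial if the supports of $I$ and $J$ are disjoint. To subduct a polynomial $f$ (over $\mathcal{B}$) is to repeatedly replace $f\neq 0$ by $f-cf^I$ with $c\in\mathbf{F}$ and $\mathrm{LT}(cf^I)=\mathrm{LT}(f)$, as long as such $c,I$ exist; the subduction of a tête-à-tête $(f^I,f^J)$ is the result of subducting $f^I-cf^J$, where the scalar $c$ is chosen so that lead terms cancel. $\mathcal{B}$ is a SAGBI basis of the algebra it generates if and only if every non-trivial tête-à-tête for $\mathcal{B}$ subducts to zero. The usual SAGBI algorithm produces a sequence $\mathcal{B}=\mathcal{B}_0\subseteq\mathcal{B}_1\subseteq\cdots$, where $\mathcal{B}_{i+1}$ is obtained from $\mathcal{B}_i$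 by subducting the non-trivial têtes-à-têtes of $\mathcal{B}_i$ and adjoining the non-zero subductions. The SAGBI/Divide-by-$x$ algorithm is the modification in which, if a non-zero subduction $f$ has lead monomial $x^m y^E$ (with $y^E$ a monomial in $y_1,\ldots,y_{n-1}$), then $fx^{-m}$ is adjoined rather than $f$. (Since the order is graded reverse lexicographic with $x$ smallest and $f$ is homogeneous, $x^m$ divides $f$.) The algorithm terminates when all non-trivial têtes-à-têtes subduct to zero. *)

(* Defs.v *)
From mathcomp Require Import all_boot all_order all_fingroup all_algebra.
From mathcomp Require Import finmap pgroup mxrepresentation mpoly.
From Stdlib Require Import Relation_Operators.

Set Implicit Arguments.
Unset Strict Implicit.
Unset Printing Implicit Defensive.

Import GRing.Theory.
Local Open Scope ring_scope.

(* Graded reverse lexicographic order for 'X_0 < 'X_1 < ... < 'X_(n-1): in a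
   given degree, a larger exponent at the first (smallest) variable where two
   monomials differ makes the monomial smaller.  The order that mpoly.v puts on
   'X_{1..n}, and hence mlead, is the graded *lexicographic* one. *)
Definition grevlex_lt n (m1 m2 : 'X_{1..n}) : bool :=
  (mdeg m1 < mdeg m2)%N ||
  (mdeg m1 == mdeg m2) &&
    [exists i : 'I_n, (m2 i < m1 i)%N &&
                      [forall j : 'I_n, (j < i)%N ==> (m1 j == m2 j)]].

Definition grevlex_max n (m1 m2 : 'X_{1..n}) : 'X_{1..n} :=
  if grevlex_lt m1 m2 then m2 else m1.

Section LeadTerm.
Variables (n : nat) (F : fieldType).
Implicit Types f : {mpoly F[n]}.

(* Junk value: LM 0 = 0%MM, hence LT 0 = 0. *)
Definition LM f : 'X_{1..n} := \big[@grevlex_max n/0%MM]_(m <- msupp f) m.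

Definition LT f : {mpoly F[n]} := f@_(LM f) *: 'X_[LM f].

End LeadTerm.

Section LeadTermTheory.
Variables (n : nat) (F : fieldType).

Lemma grevlex_ltxx (m : 'X_{1..n}) : grevlex_lt m m = false.
Proof.
rewrite /grevlex_lt ltnn eqxx /=; apply/existsP => -[i].
by rewrite ltnn.
Qed.

Lemma grevlex_lt_trans : transitive (@grevlex_lt n).
Proof.
move=> m2 m1 m3; rewrite /grevlex_lt.
case/orP => [d12|/andP[/eqP d12 /existsP[i /andP[i12 /forallP e12]]]].
  case/orP => [d23|/andP[/eqP <- _]]; last by rewrite d12.
  by rewrite (ltn_trans d12 d23).
case/orP => [d23|/andP[/eqP d23 /existsP[k /andP[k23 /forallP e23]]]].
  by rewrite d12 d23.
rewrite d12 d23 ltnn eqxx /=; apply/existsP.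
case: (ltngtP (i : nat) k) => [ik|ki|/val_inj ik].
- exists i; have /eqP <- := implyP (e23 i) ik; rewrite i12 /=.
  apply/forallP => j; apply/implyP => ji.
  by rewrite (eqP (implyP (e12 j) ji)) (implyP (e23 j) (ltn_trans ji ik)).
- exists k; have /eqP -> := implyP (e12 k) ki; rewrite k23 /=.
  apply/forallP => j; apply/implyP => jk.
  by rewrite (eqP (implyP (e12 j) (ltn_trans jk ki))) (implyP (e23 j) jk).
- subst k; exists i; rewrite (ltn_trans k23 i12) /=.
  apply/forallP => j; apply/implyP => ji.
  by rewrite (eqP (implyP (e12 j) ji)) (implyP (e23 j) ji).
Qed.

Lemma grevlex_lt_total (m1 m2 : 'X_{1..n}) :
  m1 != m2 -> grevlex_lt m1 m2 || grevlex_lt m2 m1.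
Proof.
move=> ne; rewrite /grevlex_lt.
case: (ltngtP (mdeg m1) (mdeg m2)) => //= _.
have [i0 ni0] : exists i, m1 i != m2 i.
  apply/existsP; rewrite -negb_forall; apply: contra ne => /forallP h.
  by apply/eqP/mnmP => i; apply/eqP.
case: (@arg_minnP _ i0 (fun i => m1 i != m2 i) (fun i : 'I_n => i : nat) ni0)
  => i ni mini.
have e (j : 'I_n) : (j < i)%N -> m1 j = m2 j.
  move=> ji; apply/eqP; apply: contraLR ji => /mini.
  by rewrite -leqNgt.
case: (ltngtP (m1 i) (m2 i)) ni => // lt _; apply/orP; [right|left];
  apply/existsP; exists i; rewrite lt /=; apply/forallP => j;
  by apply/implyP => /e ->; rewrite eqxx.
Qed.

Lemma grevlex_lt0 (m : 'X_{1..n}) : ~~ grevlex_lt m 0%MM.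
Proof.
rewrite /grevlex_lt mdeg0 ltn0 mdeg_eq0 /=.
by apply/negP => /andP[/eqP-> /existsP[i]]; rewrite ltnn.
Qed.

Lemma grevlex_big_max (s : seq 'X_{1..n})
    (M := \big[@grevlex_max n/0%MM]_(m <- s) m) :
  (s != [::] -> M \in s) /\ {in s, forall m, ~~ grevlex_lt M m}.
Proof.
rewrite {}/M; elim: s => [|a s [IH1 IH2]]; first by rewrite big_nil.
rewrite big_cons; set M := bigop _ _ _ in IH1 IH2 *.
have s0M : s = [::] -> M = 0%MM by move=> s0; rewrite /M s0 big_nil.
split=> [_|m]; rewrite /grevlex_max.
  case: ifP => [aM|_]; rewrite inE ?eqxx //.
  rewrite orbC; case: (eqVneq s [::]) => [/s0M M0|/IH1 -> //].
  by move: aM; rewrite M0 (negPf (grevlex_lt0 a)).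
rewrite inE => /predU1P[->|ms].
  case: ifP => [aM|_]; last by rewrite grevlex_ltxx.
  by apply/negP => /(grevlex_lt_trans aM); rewrite grevlex_ltxx.
case: ifP => [_|aM]; first exact: IH2.
apply/negP => am; have := IH2 m ms; apply/negP/negPn.
case: (eqVneq a M) => [<- //|/grevlex_lt_total]; rewrite aM /= => Ma.
exact: grevlex_lt_trans Ma am.
Qed.

Lemma LM_msupp (f : {mpoly F[n]}) : f != 0 -> LM f \in msupp f.
Proof. by rewrite -msupp_eq0; exact: (grevlex_big_max _).1. Qed.

Lemma LM_max (f : {mpoly F[n]}) : {in msupp f, forall m, ~~ grevlex_lt (LM f) m}.
Proof. exact: (grevlex_big_max _).2. Qed.

End LeadTermTheory.

Section Subalgebras.
Variables (n : nat) (F : fieldType).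
Implicit Types (A B S : {mpoly F[n]} -> Prop) (f g : {mpoly F[n]}).

Inductive alg_gen S : {mpoly F[n]} -> Prop :=
| alg_gen_mem f : S f -> alg_gen S f
| alg_gen_const c : alg_gen S c%:MP
| alg_gen_add f g : alg_gen S f -> alg_gen S g -> alg_gen S (f + g)
| alg_gen_mul f g : alg_gen S f -> alg_gen S g -> alg_gen S (f * g).

Inductive lin_span S : {mpoly F[n]} -> Prop :=
| lin_span_zero : lin_span S 0
| lin_span_add c f g : S f -> lin_span S g -> lin_span S (c *: f + g).

Definition elements_of (s : seq {mpoly F[n]}) : {mpoly F[n]} -> Prop :=
  fun f => f \in s.

Definition lead_monomials S : {mpoly F[n]} -> Prop :=
  fun g => exists f, [/\ S f, f != 0 & g = 'X_[LM f]].

Definition lead_term_algebra A := lin_span (lead_monomials A).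

Definition is_SAGBI_basis B A : Prop :=
  (forall f, B f -> A f) /\
  (forall g, alg_gen (lead_monomials B) g <-> lead_term_algebra A g).

(* A[x^-1], for x in A, as a subset of the field of fractions. *)
Definition localization A (x : {mpoly F[n]}) : {fraction {mpoly F[n]}} -> Prop :=
  fun q => exists a k, A a /\ q = tofrac a / tofrac x ^+ k.

End Subalgebras.

Section Subduction.
Variables (n : nat) (F : fieldType).
Implicit Types (B : {mpoly F[n]} -> Prop) (f g r : {mpoly F[n]}).

(* Exponent sequences are indexed by the elements of the set themselves, so
   that it need not be finite. *)
Definition exponents := {fsfun {mpoly F[n]} -> nat with 0%N}.

Definition fpow (I : exponents) : {mpoly F[n]} :=
  \prod_(f <- finsupp I) f ^+ I f.

Definition exponents_on B (I : exponents) : Prop :=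
  forall f, f \in finsupp I -> B f.

Definition tete_a_tete B (I J : exponents) : Prop :=
  [/\ exponents_on B I, exponents_on B J & LM (fpow I) = LM (fpow J)].

Definition nontrivial_tete_a_tete B (I J : exponents) : Prop :=
  tete_a_tete B I J /\ [disjoint finsupp I & finsupp J]%fset.

Definition subduct_step B f f' : Prop :=
  f != 0 /\ exists c I,
    [/\ exponents_on B I, LT (c *: fpow I) = LT f & f' = f - c *: fpow I].

Definition subducts_to B f r : Prop :=
  clos_refl_trans_1n _ (subduct_step B) f r /\
  forall r', ~ subduct_step B r r'.

Definition tete_a_tete_subducts_to B (I J : exponents) r : Prop :=
  exists c, LT (fpow I) = LT (c *: fpow J) /\
            subducts_to B (fpow I - c *: fpow J) r.

Definition all_subduct_to_zero B : Prop :=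
  forall I J, nontrivial_tete_a_tete B I J -> tete_a_tete_subducts_to B I J 0.

End Subduction.

Section DivideByX.
Variables (n : nat) (F : fieldType).
Implicit Types (B : {mpoly F[n.+1]} -> Prop) (f g : {mpoly F[n.+1]}).

(* g = f x^-m, where LM f = x^m y^E and x = 'X_0. *)
Definition divided_by_x f g : Prop := f = 'X_ord0 ^+ (LM f ord0) * g.

(* One stage B |-> B'.  T lists the subductions (f^I, f^J) ~> f carried out in
   this stage: all the non-trivial tete-a-tetes of B, or (there being infinitely
   many in general) any selection of them which, as long as not all of them
   subduct to zero, provides at least one non-zero subduction. *)
Definition sagbi_divx_step B B' : Prop :=
  exists T : exponents n.+1 F -> exponents n.+1 F -> {mpoly F[n.+1]} -> Prop,
  [/\ forall I J f, T I J f ->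
        nontrivial_tete_a_tete B I J /\ tete_a_tete_subducts_to B I J f,
      ~ all_subduct_to_zero B -> exists I J f, T I J f /\ f != 0
    & forall g, B' g <->
        B g \/ exists I J f, [/\ T I J f, f != 0 & divided_by_x f g]].

Definition sagbi_divx_run B (Bs : nat -> {mpoly F[n.+1]} -> Prop) : Prop :=
  Bs 0%N = B /\ forall i, sagbi_divx_step (Bs i) (Bs i.+1).

(* The algorithm stops at the first stage all of whose non-trivial tete-a-tetes
   subduct to zero. *)
Definition sagbi_divx_terminates_with_basis B (A : {mpoly F[n.+1]} -> Prop) : Prop :=
  (exists Bs, sagbi_divx_run B Bs) /\
  forall Bs, sagbi_divx_run B Bs ->
    (exists N, all_subduct_to_zero (Bs N)) /\
    (forall N, all_subduct_to_zero (Bs N) -> is_SAGBI_basis (Bs N) A).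

End DivideByX.

(* A representation rG makes V = 'cV_n a left module by v |-> rG g *m v, and
   hence V^* = 'rV_n a right module by u |-> u *m rG g.  The rows of an
   invertible b form a basis of V^*, and F[V] is {mpoly F[n]}, 'X_i standing
   for the linear form row i b. *)
Section Invariants.
Variables (F : fieldType) (gT : finGroupType) (G : {group gT}) (n : nat).
Variables (rG : mx_representation F G n) (b : 'M[F]_n).

Definition dual_action_mx (g : gT) : 'M[F]_n := b *m rG g *m invmx b.

Definition poly_act (g : gT) (f : {mpoly F[n]}) : {mpoly F[n]} :=
  f \mPo [tuple \sum_(j < n) dual_action_mx g i j *: 'X_j | i < n].

Definition invariant_ring (f : {mpoly F[n]}) : Prop :=
  forall g, g \in G -> poly_act g f = f.

Definition in_dual_span_le (i : 'I_n) (u : 'rV[F]_n) : bool :=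
  (u <= \sum_(j < n | (j <= i)%N) <<row j b>>)%MS.

End Invariants.

(* Main.v *)
(* Correctness.  Call lead monoid of B the monoid generated by the lead monomials
   of B.  If all non-trivial tete-a-tetes of B subduct to zero, then the lead
   monomial of every non-zero element of the algebra generated by B lies in the
   lead monoid: in an expression of f by products of B, two products with the
   same lead monomial can be merged at the expense of products with smaller lead
   monomials.  Now let f be invariant.  Then x^k f lies in that algebra for some
   k, so x^k LM(f) lies in the lead monoid; as x is the only element of B whose
   lead monomial involves x, LM(f) lies in it too.

   Termination.  A non-zero subduction f has LM(f) outside the lead monoid, and
   since x is in B, so is LM(f x^-m): the lead monoid strictly grows at each stage.
   It always contains x and the y_i^a_i, so by Dickson's lemma (comparing only
   exponents which are congruent modulo the a_i) it cannot grow for ever. *)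
Require Import Defs.
From mathcomp Require Import all_boot all_order all_fingroup all_algebra.
From mathcomp Require Import finmap pgroup mxrepresentation mpoly.
From Stdlib Require Import Classical IndefiniteDescription Relation_Operators.

Set Implicit Arguments.
Unset Strict Implicit.
Unset Printing Implicit Defensive.

Import GRing.Theory.
Local Open Scope ring_scope.

(** * Grevlex as a monomial order: translation invariance and well-foundedness *)

Section MonomialOrder.
Variable n : nat.
Implicit Types m : 'X_{1..n}.

Lemma grevlex_lt_add2r m m1 m2 :
  grevlex_lt (m1 + m)%MM (m2 + m)%MM = grevlex_lt m1 m2.
Proof.
rewrite /grevlex_lt !mdegD ltn_add2r eqn_add2r; congr (_ || _ && _).
apply: eq_existsb => i; rewrite !mnmDE ltn_add2r; congr (_ && _).
by apply: eq_forallb => j; rewrite !mnmDE eqn_add2r.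
Qed.

Lemma grevlex_lt_add2l m m1 m2 :
  grevlex_lt (m + m1)%MM (m + m2)%MM = grevlex_lt m1 m2.
Proof. by rewrite ![(m + _)%MM]addmC grevlex_lt_add2r. Qed.

Lemma grevlex_lt_mdeg m1 m2 : grevlex_lt m1 m2 -> (mdeg m1 <= mdeg m2)%N.
Proof. by case/orP => [/ltnW //|/andP[/eqP-> _]]. Qed.

Lemma grevlex_ltgtP m1 m2 :
  [\/ m1 = m2, grevlex_lt m1 m2 | grevlex_lt m2 m1].
Proof.
case: (eqVneq m1 m2) => [->|/grevlex_lt_total/orP[h|h]].
- exact: Or31.
- exact: Or32.
- exact: Or33.
Qed.

Lemma grevlex_le_lt_trans m1 m2 m3 :
  ~~ grevlex_lt m2 m1 -> grevlex_lt m2 m3 -> grevlex_lt m1 m3.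
Proof.
case: (grevlex_ltgtP m1 m2) => [-> //|h _|-> //].
exact: grevlex_lt_trans h.
Qed.

(** Everything below [m0] has degree at most [D], and only finitely many monomials do. Counting
    those of them that lie below [m] gives a natural number which drops along the order. *)
Lemma grevlex_wf : well_founded (@grevlex_lt n).
Proof.
move=> m0; pose D := mdeg m0.
have [rank rank_lt] : exists rank : 'X_{1..n} -> nat, forall m' m,
    (mdeg m' <= D)%N -> grevlex_lt m' m -> (rank m' < rank m)%N.
  exists (fun m => #|[pred k : 'X_{1..n < D.+1} | grevlex_lt k m]|).
  move=> m' m m'D m'm; apply/proper_card/properP; split.
    by apply/subsetP => k; rewrite !inE => /grevlex_lt_trans; apply.
  by exists (BMultinom (m'D : (mdeg m' < D.+1)%N)); rewrite !inE //= grevlex_ltxx.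
suff acc r m : (rank m < r)%N -> (mdeg m <= D)%N -> Acc (@grevlex_lt n) m.
  exact: (acc (rank m0).+1 m0 (ltnSn _) (leqnn _)).
elim: r m => [|r IH] m rm mD; first by rewrite ltn0 in rm.
constructor=> m' m'm.
have m'D := leq_trans (grevlex_lt_mdeg m'm) mD.
by apply: IH => //; rewrite -ltnS; apply: leq_trans (rank_lt _ _ m'D m'm) rm.
Qed.

End MonomialOrder.

(** * Lead monomials of products, multiples and differences *)

Section LeadMonomial.
Variables (n : nat) (F : fieldType).
Implicit Types (f g : {mpoly F[n]}) (m : 'X_{1..n}).

Lemma LM_eq f m :
  f@_m != 0 -> {in msupp f, forall k, ~~ grevlex_lt m k} -> LM f = m.
Proof.
rewrite -mcoeff_msupp => mf max.
have f0 : f != 0 by apply: contraTneq mf => ->; rewrite msupp0.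
case: (grevlex_ltgtP (LM f) m) => // h.
  by have := LM_max mf; rewrite h.
by have := max _ (LM_msupp f0); rewrite h.
Qed.

Lemma LM_coef_neq0 f : f != 0 -> f@_(LM f) != 0.
Proof. by move=> f0; rewrite -mcoeff_msupp LM_msupp. Qed.

Lemma mpolyX_neq0 m : 'X_[m] != 0 :> {mpoly F[n]}.
Proof. by rewrite -msupp_eq0 msuppX. Qed.

Lemma LM_X m : LM ('X_[m] : {mpoly F[n]}) = m.
Proof.
apply: LM_eq; first by rewrite mcoeffX eqxx oner_eq0.
by move=> k; rewrite msuppX inE => /eqP ->; rewrite grevlex_ltxx.
Qed.

Lemma LM_1 : LM (1 : {mpoly F[n]}) = 0%MM.
Proof. by rewrite -mpolyX0 LM_X. Qed.

Lemma LM_M_proof f g (m := (LM f + LM g)%MM) : f != 0 -> g != 0 ->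
  (f * g)@_m = f@_(LM f) * g@_(LM g) /\
  {in msupp (f * g), forall k, ~~ grevlex_lt m k}.
Proof.
move=> f0 g0; split; last first.
  move=> k /msuppM_le /allpairsP[[k1 k2] /= [k1f k2g ->]].
  apply: contra (LM_max k1f) => h; move: (LM_max k2g).
  case: (grevlex_ltgtP k2 (LM g)) => [e|h2|-> //].
    by move: h; rewrite e grevlex_lt_add2r.
  move: h2; rewrite -(grevlex_lt_add2l k1) => /(grevlex_lt_trans h).
  by rewrite grevlex_lt_add2r.
rewrite [in LHS](mpolyE f) mulr_suml raddf_sum /=.
rewrite (bigD1_seq (LM f)) ?LM_msupp ?msupp_uniq //=.
rewrite big_seq_cond big1 ?addr0.
  by rewrite -scalerAl mcoeffZ mulrC -commr_mpolyX mcoeffMX mulrC.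
(* A monomial [k] of [f] other than [LM f] lies below it, so [k + k2 = LM f + LM g] would force [k2]
   above [LM g]. *)
move=> k /andP[kf kLM]; rewrite -scalerAl mcoeffZ.
apply/eqP; rewrite mulf_eq0; apply/orP; right.
rewrite -commr_mpolyX mcoeff_eq0.
rewrite (perm_mem (msuppMX _ _)).
apply/mapP => -[k2 k2g e].
have kl : grevlex_lt k (LM f).
  by case/orP: (grevlex_lt_total kLM) => // h; have := LM_max kf; rewrite h.
have := LM_max k2g; rewrite -(grevlex_lt_add2l (LM f)) -/m e.
by rewrite grevlex_lt_add2r kl.
Qed.

Lemma LM_mul f g : f != 0 -> g != 0 -> LM (f * g) = (LM f + LM g)%MM.
Proof.
move=> f0 g0; have [c max] := LM_M_proof f0 g0.
by apply: LM_eq => //; rewrite c mulf_neq0 ?LM_coef_neq0.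
Qed.

Lemma LM_scale c f : c != 0 -> LM (c *: f) = LM f.
Proof.
move=> c0; case: (eqVneq f 0) => [->|f0]; first by rewrite scaler0.
apply: LM_eq; first by rewrite mcoeffZ mulf_neq0 ?LM_coef_neq0.
by move=> k; rewrite (perm_mem (msuppZ _ c0)) => /LM_max.
Qed.

Lemma LT_coef f m : (LT f)@_m = f@_(LM f) * (LM f == m)%:R.
Proof. by rewrite mcoeffZ mcoeffX. Qed.

Lemma LT_inj f g : f != 0 -> LT f = LT g ->
  LM f = LM g /\ f@_(LM f) = g@_(LM f).
Proof.
move=> f0 /(congr1 (mcoeff (LM f))); rewrite !LT_coef eqxx mulr1.
case: eqVneq => [-> ->|_]; first by rewrite mulr1.
by rewrite mulr0 => /eqP; rewrite (negPf (LM_coef_neq0 f0)).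
Qed.

Lemma LM_sub_lt f g : LT f = LT g -> f - g != 0 ->
  grevlex_lt (LM (f - g)) (LM f).
Proof.
(* [LT 0 = 0], whereas a non-zero polynomial has a non-zero lead term: here [g] would vanish as
   well. *)
case: (eqVneq f 0) => [->|f0].
  move=> e fg0; have g0 : g != 0 by move: fg0; rewrite sub0r oppr_eq0.
  have [_ /esym/eqP] := LT_inj g0 (esym e).
  by rewrite mcoeff0 eq_sym (negPf (LM_coef_neq0 g0)).
move=> e fg0; have [eLM ec] := LT_inj f0 e.
have LMs := LM_msupp fg0.
case: (grevlex_ltgtP (LM (f - g)) (LM f)) => // [eq|h].
  by move: LMs; rewrite mcoeff_msupp eq mcoeffB ec subrr eqxx.
have /msuppB_le := LMs; rewrite mem_cat => /orP[/LM_max|/LM_max].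
  by rewrite h.
by rewrite -eLM h.
Qed.

End LeadMonomial.

(** * Linear spans and generated algebras *)

Section LinearSpan.
Variables (n : nat) (F : fieldType).
Implicit Types (S : {mpoly F[n]} -> Prop) (f g : {mpoly F[n]}).

Lemma lin_span_mem S f : S f -> lin_span S f.
Proof.
by move=> Sf; rewrite -[f]addr0 -[f]scale1r; apply: lin_span_add => //; left.
Qed.

Lemma lin_spanD S f g : lin_span S f -> lin_span S g -> lin_span S (f + g).
Proof.
move=> Sf Sg; elim: Sf => [|c h k Sh _ IH]; first by rewrite add0r.
by rewrite -addrA; apply: lin_span_add.
Qed.

Lemma lin_spanZ S c f : lin_span S f -> lin_span S (c *: f).
Proof.
elim=> [|d h k Sh _ IH]; first by rewrite scaler0; left.
by rewrite scalerDr scalerA; apply: lin_span_add.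
Qed.

Lemma lin_span_mull S S' g f :
  (forall h, S h -> lin_span S' (g * h)) ->
  lin_span S f -> lin_span S' (g * f).
Proof.
move=> SS'; elim=> [|d h k Sh _ IH]; first by rewrite mulr0; left.
by rewrite mulrDr -scalerAr; apply/lin_spanD/IH/lin_spanZ/SS'.
Qed.

Lemma lin_spanM S f g : (forall h k, S h -> S k -> S (h * k)) ->
  lin_span S f -> lin_span S g -> lin_span S (f * g).
Proof.
move=> SM Sf Sg; rewrite mulrC; apply: lin_span_mull Sf => h Sh.
rewrite mulrC; apply: lin_span_mull Sg => k Sk.
exact/lin_span_mem/SM.
Qed.

Lemma alg_gen_lin_span S f :
  S 1 -> (forall g h, S g -> S h -> S (g * h)) -> alg_gen S f -> lin_span S f.
Proof.
move=> S1 SM; elim=> {f} [f Sf|c|f g _ Sf _ Sg|f g _ Sf _ Sg].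
- exact: lin_span_mem.
- by rewrite -[c%:MP]mulr1 mul_mpolyC; apply/lin_spanZ/lin_span_mem.
- exact: lin_spanD.
- exact: lin_spanM.
Qed.

Lemma alg_gen_sub S S' f :
  (forall g, S g -> S' g) -> alg_gen S f -> alg_gen S' f.
Proof.
move=> SS'; elim=> {f} [f Sf|c|f g _ Sf _ Sg|f g _ Sf _ Sg].
- exact/alg_gen_mem/SS'.
- exact: alg_gen_const.
- exact: alg_gen_add.
- exact: alg_gen_mul.
Qed.

(** Among the finitely many elements of a linear combination, one has the largest lead monomial. It
    supplies the bound on which [LM_bounded_span] does its induction. *)
Lemma lin_span_LM_max S f : lin_span S f ->
  f = 0 \/ exists2 g, S g & lin_span (fun h => S h /\ ~~ grevlex_lt (LM g) (LM h)) f.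
Proof.
elim=> [|c g h Sg _ [->|[k Sk IH]]]; [by left| |]; right.
  exists g => //; apply/lin_span_add; last by left.
  by rewrite grevlex_ltxx.
have [kg|gk] := boolP (grevlex_lt (LM k) (LM g)); last first.
  by exists k => //; apply: lin_span_add.
exists g => //; apply: lin_span_add; first by rewrite grevlex_ltxx.
elim: IH => [|d u v [Su uk] _ IH]; [by left|apply: lin_span_add => //; split=> //].
by apply: contra uk; apply: grevlex_lt_trans.
Qed.

End LinearSpan.

(** * The multiplicative monoid generated by [B] *)

Section Products.
Variables (n : nat) (F : fieldType).
Implicit Types (B : {mpoly F[n]} -> Prop) (f g : {mpoly F[n]}).
Implicit Types (I J : exponents n F).

(** Meant for sum, minimum and truncated difference, which send two zeros to zero, in agreement with
    the default value off the joint support. *)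
Definition fexp_map2 (op : nat -> nat -> nat) I J : exponents n F :=
  [fsfun f in (finsupp I `|` finsupp J)%fset => op (I f) (J f)].

Lemma fexp_map2E op I J f : op 0%N 0%N = 0%N -> fexp_map2 op I J f = op (I f) (J f).
Proof.
move=> op0; rewrite fsfunE; case: ifP => // /negbT; rewrite in_fsetU negb_or.
by rewrite !memNfinsupp => /andP[/eqP-> /eqP->].
Qed.

Lemma fpow_widen (S : {fset {mpoly F[n]}}) I :
  (finsupp I `<=` S)%fset -> fpow I = \prod_(f <- S) f ^+ I f.
Proof.
move=> sub; apply: big_fset_incl => // f _.
by rewrite memNfinsupp => /eqP ->.
Qed.

Lemma fpow_eq_mul I J (K : exponents n F) :
  (forall f, I f = (J f + K f)%N) -> fpow I = fpow J * fpow K.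
Proof.
move=> IJK; pose S := (finsupp I `|` (finsupp J `|` finsupp K))%fset.
rewrite !(@fpow_widen S) -?big_split /=.
- by apply: eq_bigr => f _; rewrite IJK exprD.
- exact: fsubset_trans (fsubsetUr _ _) (fsubsetUr _ _).
- exact: fsubset_trans (fsubsetUl _ _) (fsubsetUr _ _).
- exact: fsubsetUl.
Qed.

Definition products B f : Prop := exists2 I, exponents_on B I & f = fpow I.

Lemma products_fpow B I : exponents_on B I -> products B (fpow I).
Proof. by exists I. Qed.

Lemma products1 B : products B 1.
Proof.
by exists [fsfun] => [f|]; rewrite ?in_finsupp0 // /fpow finsupp0 big_seq_fset0.
Qed.

Lemma products_mem B f : B f -> products B f.
Proof.
move=> Bf; pose I : exponents n F := [fsfun g in [fset f]%fset => 1%N].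
have sub : (finsupp I `<=` [fset f])%fset by exact: finsupp_sub.
exists I => [g /(fsubsetP sub)|]; first by rewrite inE => /eqP ->.
by rewrite (fpow_widen sub) big_seq_fset1 fsfunE inE eqxx expr1.
Qed.

Lemma productsM B f g : products B f -> products B g -> products B (f * g).
Proof.
move=> [I BI ->] [J BJ ->]; exists (fexp_map2 addn I J) => [h|].
  rewrite mem_finsupp fexp_map2E // addn_eq0 negb_and -!mem_finsupp.
  by case/orP => [/BI|/BJ].
by apply/esym/fpow_eq_mul => h; rewrite fexp_map2E.
Qed.

Lemma products_ind B (P : {mpoly F[n]} -> Prop) :
  P 1 -> (forall f g, B f -> P g -> P (f * g)) -> forall f, products B f -> P f.
Proof.
move=> P1 PM _ [I BI ->]; rewrite /fpow big_seq.
apply: (big_rec P) => // f g /BI Bf Pg.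
by elim: (I f) => [|k IH]; [rewrite mul1r|rewrite exprS -mulrA; apply: PM].
Qed.

Lemma products_neq0 B f : (forall g, B g -> g != 0) -> products B f -> f != 0.
Proof.
move=> B0 [I BI ->]; rewrite /fpow prodf_seq_neq0.
by apply/allP => g /BI /B0 g0; rewrite expf_neq0.
Qed.

(** Take the minimum of [I] and [J] as [K] and the two truncated differences as [I'] and [J']. This
    reduces an arbitrary tete-a-tete to a non-trivial one. *)
Lemma fpow_common_factor B I J : exponents_on B I -> exponents_on B J ->
  exists K I' J', [/\ exponents_on B K, exponents_on B I', exponents_on B J',
    [disjoint finsupp I' & finsupp J']%fset &
    fpow I = fpow K * fpow I' /\ fpow J = fpow K * fpow J'].
Proof.
move=> BI BJ; exists (fexp_map2 minn I J), (fexp_map2 subn I J), (fexp_map2 subn J I).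
have E op f := @fexp_map2E op I J f; have E' := @fexp_map2E subn J I.
split; [move=> f|move=> f|move=> f| |split; apply: fpow_eq_mul => f].
- rewrite mem_finsupp E // => h; apply: BI; rewrite mem_finsupp.
  by apply: contraNneq h => ->; rewrite min0n.
- rewrite mem_finsupp E // => h; apply: BI; rewrite mem_finsupp.
  by apply: contraNneq h => ->; rewrite sub0n.
- rewrite mem_finsupp E' // => h; apply: BJ; rewrite mem_finsupp.
  by apply: contraNneq h => ->; rewrite sub0n.
- apply/fdisjointP => f; rewrite memNfinsupp mem_finsupp E // E' //.
  by rewrite subn_eq0 -ltnNge => /ltnW; rewrite -subn_eq0.
- by rewrite !E // minnE subnK // leq_subr.
- by rewrite E // E' // minnC minnE subnK // leq_subr.
Qed.

End Products.

(** * Subduction, and lead monomials when all tete-a-tetes subduct to zero *)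

Section Subductions.
Variables (n : nat) (F : fieldType) (B : {mpoly F[n]} -> Prop).
Implicit Types (f g r : {mpoly F[n]}) (I J : exponents n F).

Lemma subduct_stepP f f' : subduct_step B f f' ->
  exists c p, [/\ products B p, c != 0, p != 0, LM p = LM f & f' = f - c *: p]
              /\ (f' = 0 \/ grevlex_lt (LM f') (LM f)).
Proof.
case=> f0 [c [I [BI eLT ->]]]; exists c, (fpow I).
have [eLM ec] := LT_inj f0 (esym eLT).
have : c *: fpow I != 0.
  apply: contraNneq (LM_coef_neq0 f0) => cI0.
  by rewrite ec cI0 mcoeff0.
rewrite scaler_eq0 negb_or => /andP[c0 I0]; split.
  by split=> //; [exists I | rewrite eLM LM_scale].
by case: (eqVneq (f - c *: fpow I) 0) => [|/(LM_sub_lt (esym eLT))]; [left|right].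
Qed.

Lemma subduct_ind (P : {mpoly F[n]} -> Prop) f r :
  (forall c p g, P g -> g != 0 -> products B p -> p != 0 -> LM p = LM g ->
     P (g - c *: p)) ->
  P f -> subducts_to B f r -> P r.
Proof.
move=> stepP + [st _]; elim: st => // {}f g {}r fg; have [f0 _] := fg.
case: (subduct_stepP fg) => c [p [[Bp _ p0 ep ->] _]] _ IH Pf.
by apply/IH/stepP.
Qed.

Lemma subducts_to_exists f : exists r, subducts_to B f r.
Proof.
(* Zero is treated apart: [LM 0] is a default value, so a step that reaches 0 from a constant does
   not lower the lead monomial. *)
have sub0 : subducts_to B 0 0.
  by split=> [|r' []]; [exact: rt1n_refl|rewrite eqxx].
elim/(well_founded_ind (@grevlex_wf n)): (LM f) {-2}f (erefl (LM f)) => m IH {}f fm.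
case: (classic (exists f', subduct_step B f f')) => [[f' ff']|nf]; last first.
  by exists f; split=> [|r' fr']; [exact: rt1n_refl|apply: nf; exists r'].
have [r [fr rr]] : exists r, subducts_to B f' r.
  have [c [p [_ [->|lt]]]] := subduct_stepP ff'; first by exists 0.
  by apply: IH (erefl _); rewrite -fm.
by exists r; split=> //; apply: rt1n_trans ff' fr.
Qed.

(** Otherwise one more step would apply to [r], with the quotient of the lead coefficients as
    scalar. *)
Lemma subducts_to_LM f r : subducts_to B f r -> r != 0 ->
  forall p, products B p -> p != 0 -> LM p <> LM r.
Proof.
move=> [_ nr] r0 _ [I BI ->] p0 e; have c0 := LM_coef_neq0 p0.
pose c := r@_(LM r) / (fpow I)@_(LM r).
apply: (nr (r - c *: fpow I)); split=> //; exists c, I; split=> //.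
rewrite /LT LM_scale ?e; last first.
  by rewrite mulf_neq0 ?invr_eq0 -?e ?c0 // e LM_coef_neq0.
by rewrite mcoeffZ divfK // -e.
Qed.

Lemma tete_a_tete_scalar I J : (forall f, B f -> f != 0) -> tete_a_tete B I J ->
  exists c, LT (fpow I) = LT (c *: fpow J).
Proof.
move=> B0 [BI BJ e].
have I0 := LM_coef_neq0 (products_neq0 B0 (products_fpow BI)).
have J0 := LM_coef_neq0 (products_neq0 B0 (products_fpow BJ)).
exists ((fpow I)@_(LM (fpow I)) / (fpow J)@_(LM (fpow J))).
by rewrite /LT LM_scale ?mulf_neq0 ?invr_eq0 // mcoeffZ divfK // e.
Qed.

Definition low_products mu f := products B f /\ grevlex_lt (LM f) mu.

Lemma low_span_msupp mu f : lin_span (low_products mu) f ->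
  {in msupp f, forall m, grevlex_lt m mu}.
Proof.
elim=> [|c g h [_ lt] _ IH] m; first by rewrite msupp0.
move/msuppD_le; rewrite mem_cat => /orP[/msuppZ_le/LM_max gm|/IH //].
exact: grevlex_le_lt_trans gm lt.
Qed.

(** Summing up what the subduction subtracts recovers [f], and lead monomials only go down along the
    way. *)
Lemma subduct_to0_low_span mu f : subducts_to B f 0 ->
  f = 0 \/ grevlex_lt (LM f) mu -> lin_span (low_products mu) f.
Proof.
case=> st _.
(* The end point 0 becomes a variable so that induction on the closure applies. *)
have [z st' z0] : exists2 z, clos_refl_trans_1n _ (subduct_step B) f z & z = 0.
  by exists 0.
elim: st' z0 => {f st z} [f -> _|f g z]; first by left.
case/subduct_stepP=> c [p [[Bp _ _ ep ->] ltg]] _ IH z0.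
case=> [f0|ltf]; first by rewrite f0; left.
rewrite -[f](subrK (c *: p)) addrC; apply: lin_span_add.
  by split=> //; rewrite ep.
by apply: IH => //; case: ltg => [->|ltg]; [left|right; apply: grevlex_lt_trans ltf].
Qed.

Hypothesis B_neq0 : forall f, B f -> f != 0.
Hypothesis B_tete : all_subduct_to_zero B.

(** Without their common factor, [p] and [q] form a non-trivial tete-a-tete, whose difference is a
    combination of lower products. Multiplying back by the common factor preserves the strict
    inequalities. *)
Lemma products_eq_LM_low p q : products B p -> products B q -> LM p = LM q ->
  exists c, lin_span (low_products (LM p)) (p - c *: q).
Proof.
move=> [I BI ->] [J BJ ->].
have [K [I' [J' [BK BI' BJ' dis [-> ->]]]]] := fpow_common_factor BI BJ.
have neq0 L : exponents_on B L -> fpow L != 0.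
  by move=> BL; apply: products_neq0 (products_fpow BL).
rewrite !LM_mul ?neq0 // => /addmI e.
have [c [eLT sub]] := B_tete (I := I') (J := J') (conj (And3 BI' BJ' e) dis).
exists c; rewrite scalerAr -mulrBr.
apply: (lin_span_mull _ (subduct_to0_low_span (mu := LM (fpow I')) sub _)) =>
  [h [Bh lt]|].
  have h0 := products_neq0 B_neq0 Bh.
  apply: lin_span_mem; split; first exact: (productsM (products_fpow BK)).
  by rewrite LM_mul ?neq0 // grevlex_lt_add2l; exact: lt.
by case: (eqVneq (fpow I' - c *: fpow J') 0) => [|/(LM_sub_lt eLT)]; [left|right].
Qed.

(** All terms with lead monomial exactly [mu] are merged into a multiple of a single product, at the
    expense of lower terms. *)
Lemma bounded_span_split mu f :
  lin_span (fun p => products B p /\ ~~ grevlex_lt mu (LM p)) f ->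
  lin_span (low_products mu) f \/
  exists p c, [/\ products B p, LM p = mu & lin_span (low_products mu) (f - c *: p)].
Proof.
elim=> [|c g h [Bg gmu] _ IH]; first by left; left.
case: (grevlex_ltgtP (LM g) mu) => [e|lt|]; last by rewrite (negPf gmu).
  right; case: IH => [low|[p [d [Bp ep low]]]].
    by exists g, c; split=> //; rewrite addrAC subrr add0r.
  have [a glow] := products_eq_LM_low Bg Bp (etrans e (esym ep)).
  exists p, (c * a + d); split=> //.
  rewrite scalerDl opprD addrACA -scalerA -scalerBr.
  by apply/lin_spanD/low/lin_spanZ; rewrite -e.
case: IH => [low|[p [d [Bp ep low]]]]; first by left; apply: lin_span_add.
by right; exists p, d; split=> //; rewrite -addrA; apply: lin_span_add.
Qed.

(** Well-founded induction on the bound. After merging, either one product at [mu] survives with a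
    non-zero coefficient and nothing can cancel it, or all terms are lower and the bound
    decreases. *)
Lemma LM_bounded_span mu f :
  lin_span (fun p => products B p /\ ~~ grevlex_lt mu (LM p)) f -> f != 0 ->
  exists2 p, products B p & LM p = LM f.
Proof.
elim/(well_founded_ind (@grevlex_wf n)): mu f => mu IH f fmu f0.
have low_case : lin_span (low_products mu) f -> exists2 p, products B p & LM p = LM f.
  case/lin_span_LM_max => [fz|[g [_ lt] fg]]; first by rewrite fz eqxx in f0.
  apply: (IH _ lt) => //; elim: fg => [|c p q [[Bp _] pg] _ IHq]; first by left.
  exact: lin_span_add.
case: (bounded_span_split fmu) => [//|[p [c [Bp ep low]]]].
case: (eqVneq c 0) low => [->|c0 low]; first by rewrite scale0r subr0.
exists p => //; apply/esym; rewrite ep.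
have supp := low_span_msupp low; have p0 := products_neq0 B_neq0 Bp.
apply: LM_eq => [|m].
  rewrite -[f](subrK (c *: p)) mcoeffD [X in X + _]memN_msupp_eq0.
    by rewrite add0r mcoeffZ mulf_neq0 // -ep LM_coef_neq0.
  by apply/negP => /supp; rewrite grevlex_ltxx.
rewrite -[f](subrK (c *: p)) => /msuppD_le; rewrite mem_cat => /orP[/supp lt|].
  by apply/negP => /(grevlex_lt_trans lt); rewrite grevlex_ltxx.
by move/msuppZ_le/LM_max; rewrite ep.
Qed.

Lemma LM_alg_gen f : alg_gen B f -> f != 0 -> exists2 p, products B p & LM p = LM f.
Proof.
move=> Bf f0; have : lin_span (products B) f.
  apply: alg_gen_lin_span (products1 B) (@productsM _ _ B) _.
  by apply: alg_gen_sub Bf; exact: products_mem.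
by case/lin_span_LM_max => [fz|[g _ /LM_bounded_span]]; [rewrite fz eqxx in f0|apply].
Qed.

End Subductions.

(** * Dickson's lemma, plain and with congruences *)

Section Dickson.

Definition infinite (T : nat -> Prop) := forall N, exists2 k, (N <= k)%N & T k.

(** Keep the indices of [T] whose value is at most every later value on [T]. *)
Lemma infinite_nondecreasing (u : nat -> nat) (T : nat -> Prop) : infinite T ->
  exists2 T', infinite T' & (forall k, T' k -> T k) /\
    forall i j, T' i -> T' j -> (i <= j)%N -> (u i <= u j)%N.
Proof.
move=> infT.
exists (fun k => T k /\ forall j, T j -> (k <= j)%N -> (u k <= u j)%N); last first.
  by split=> [k []|i j [_ ui] [Tj _]] //; apply: ui.
move=> N; have [k0 Nk0 Tk0] := infT N.
(* Induction on the value at [k0]: either [k0] is kept, or a later index of [T] has a smaller value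
   and replaces it. *)
have [r] := ubnP (u k0); elim: r => // r IH in k0 Nk0 Tk0 *; rewrite ltnS => ur.
case: (classic (exists j, [/\ T j, (k0 <= j)%N & (u j < u k0)%N])).
  case=> j [Tj k0j uj]; apply: (IH j) => //; first exact: leq_trans k0j.
  exact: leq_trans uj ur.
move=> nex; exists k0 => //; split=> // j Tj k0j.
by rewrite leqNgt; apply/negP => uj; apply: nex; exists j.
Qed.

(** The index set is thinned once per coordinate until every coordinate is non-decreasing on it; any
    two remaining indices then do. *)
Lemma Dickson (I : finType) (u : I -> nat -> nat) :
  exists i j, (i < j)%N /\ forall a, (u a i <= u a j)%N.
Proof.
have [T infT mono] : exists2 T, infinite T & forall a, a \in enum I ->
    forall i j, T i -> T j -> (i <= j)%N -> (u a i <= u a j)%N.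
  elim: (enum I) => [|a s [T infT IH]]; first by exists (fun=> True) => // N; exists N.
  have [T' infT' [T'T mono]] := infinite_nondecreasing (u a) infT.
  exists T' => // b; rewrite inE => /predU1P[->|bs] i j Ti Tj; first exact: mono.
  by apply: IH => //; apply: T'T.
have [i _ Ti] := infT 0%N; have [j ij Tj] := infT i.+1.
by exists i, j; split=> // a; apply: mono; rewrite ?mem_enum // ltnW.
Qed.

Lemma Dickson_mod n (d : 'I_n -> nat) (m : nat -> 'X_{1..n}) :
  (forall a, 0 < d a)%N ->
  exists i j (k : 'I_n -> nat), (i < j)%N /\ forall a, m j a = (m i a + d a * k a)%N.
Proof.
move=> d0.
(* The third coordinate, being complementary to the second, makes both constant. *)
pose u (x : 'I_n * option bool) k := match x.2 with
  | None => m k x.1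
  | Some true => (m k x.1 %% d x.1)%N
  | Some false => (d x.1 - m k x.1 %% d x.1)%N end.
have [i [j [ij le]]] := Dickson u.
exists i, j, (fun a => (m j a - m i a) %/ d a)%N; split=> // a.
have := le (a, None); have := le (a, Some true); have := le (a, Some false).
rewrite /u /= => le3 le2 le1.
have e : (m i a %% d a = m j a %% d a)%N.
  apply/eqP; rewrite eqn_leq le2 leqNgt; apply: contraL le3 => lt.
  by rewrite -ltnNge ltn_sub2l // ltn_pmod.
by rewrite mulnC divnK ?subnKC // -eqn_mod_dvd // e.
Qed.

End Dickson.

(** * The monoid of lead monomials of products *)

Section LeadMonoid.
Variables (n : nat) (F : fieldType) (B : {mpoly F[n]} -> Prop).
Hypothesis B_neq0 : forall f, B f -> f != 0.

Definition lead_monoid m := exists2 p, products B p & LM p = m.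

Lemma lead_monoid0 : lead_monoid 0%MM.
Proof. by exists 1; [exact: products1|rewrite LM_1]. Qed.

Lemma lead_monoidD m1 m2 : lead_monoid m1 -> lead_monoid m2 -> lead_monoid (m1 + m2)%MM.
Proof.
move=> [p Bp <-] [q Bq <-]; exists (p * q); first exact: productsM.
by rewrite LM_mul // ?(products_neq0 B_neq0).
Qed.

Lemma lead_monoidMn m k : lead_monoid m -> lead_monoid (m *+ k)%MM.
Proof.
move=> Bm; elim: k => [|k IH]; first by rewrite mulm0n; exact: lead_monoid0.
by rewrite mulmS; apply: lead_monoidD.
Qed.

Lemma lead_monoid_mem f : B f -> lead_monoid (LM f).
Proof. by exists f => //; apply: products_mem. Qed.

Lemma lead_monoid_alg_gen m : lead_monoid m -> alg_gen (lead_monomials B) 'X_[m].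
Proof.
(* Non-vanishing is carried through the induction because [LM_mul] requires it of both factors. *)
case=> p Bp <-; suff [] : p != 0 /\ alg_gen (lead_monomials B) 'X_[LM p] by [].
elim/products_ind: p / Bp => [|f g Bf [g0 IH]].
  by rewrite oner_neq0 LM_1 mpolyX0 -mpolyC1; split=> //; exact: alg_gen_const.
have f0 := B_neq0 Bf; rewrite mulf_neq0 //; split=> //.
rewrite LM_mul // mpolyXD; apply: alg_gen_mul IH.
by apply: alg_gen_mem; exists f.
Qed.

End LeadMonoid.

(** * The SAGBI/Divide-by-x algorithm over an abstract algebra [A] *)

Section DivideByX.
Variables (n : nat) (F : fieldType).
Implicit Types (f g : {mpoly F[n.+1]}) (B : {mpoly F[n.+1]} -> Prop).
Implicit Types (I J : exponents n.+1 F).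

Lemma mdeg_LM_dhomog d f : f != 0 -> f \is d.-homog -> mdeg (LM f) = d.
Proof. by move=> f0 /dhomogP; apply; apply: LM_msupp. Qed.

(** All monomials of [f] have the same degree and grevlex looks at x first, so a monomial with a
    smaller power of x than [LM f] would exceed [LM f]. Hence the truncated subtraction of exponents
    is exact. *)
Lemma divided_by_x_exists d f : f != 0 -> f \is d.-homog -> exists g, divided_by_x f g.
Proof.
move=> f0 df; pose k := LM f ord0.
exists (\sum_(m <- msupp f) f@_m *: 'X_[m - U_(ord0) *+ k]).
rewrite /divided_by_x [LHS]mpolyE mulr_sumr; apply: eq_big_seq => m mf.
rewrite -scalerAr mpolyXn -mpolyXD; congr (_ *: 'X_[_]).
apply/mnmP => i; rewrite mnmDE mnmBE mulmnE mnm1E subnKC //.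
case: eqVneq => [<-|_]; last by rewrite mul0n.
rewrite mul1n leqNgt; apply: contra (LM_max mf) => lt.
rewrite /grevlex_lt (mdeg_LM_dhomog f0 df) (dhomog_mf df mf) eqxx.
apply/orP; right; apply/existsP; exists ord0; rewrite lt.
by apply/forallP => j; rewrite ltn0.
Qed.

Lemma divided_by_xP d f g : f != 0 -> f \is d.-homog -> divided_by_x f g ->
  [/\ g != 0, LM f = (U_(ord0) *+ LM f ord0 + LM g)%MM, LM g ord0 = 0%N &
      exists e, g \is e.-homog].
Proof.
move=> f0 df e; have g0 : g != 0 by apply: contraNneq f0; rewrite e => ->; rewrite mulr0.
have eLM : LM f = (U_(ord0) *+ LM f ord0 + LM g)%MM.
  by rewrite {1}e mpolyXn LM_mul ?LM_X // mpolyX_neq0.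
split=> //.
  move/(congr1 (fun m : 'X_{1..n.+1} => m ord0))/eqP: eLM.
  by rewrite mnmDE mulmnE mnm1E eqxx mul1n -[X in X == _]addn0 eqn_add2l => /eqP.
(* Multiplying a monomial of [g] by the removed power of x gives a monomial of [f], whose degree is
   known. *)
exists (mdeg (LM g)); apply/dhomogP => m mg.
suff : mdeg (U_(ord0) *+ LM f ord0 + m) = mdeg (LM f).
  by rewrite [in RHS]eLM !mdegD => /addnI.
rewrite (mdeg_LM_dhomog f0 df); apply: (dhomog_mf df).
by rewrite [f in msupp f]e mpolyXn mulrC mcoeff_msupp mcoeffMX -mcoeff_msupp.
Qed.

(** The largest possible stage, which treats all non-trivial tete-a-tetes at once; iterating it
    shows that a run exists. *)
Definition divx_adjoin B g : Prop := B g \/ exists I J f,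
  [/\ nontrivial_tete_a_tete B I J /\ tete_a_tete_subducts_to B I J f,
      f != 0 & divided_by_x f g].

(** Progress holds because every tete-a-tete has some subduction: if none of these were non-zero,
    all tete-a-tetes would subduct to zero. *)
Lemma sagbi_divx_step_adjoin B :
  (forall f, B f -> f != 0) -> sagbi_divx_step B (divx_adjoin B).
Proof.
move=> B0; exists (fun I J f =>
  nontrivial_tete_a_tete B I J /\ tete_a_tete_subducts_to B I J f); split=> //.
move=> nB; apply: NNPP => nex; apply: nB => I J IJ.
have [c ec] := tete_a_tete_scalar B0 IJ.1.
have [r sub] := subducts_to_exists B (fpow I - c *: fpow J).
case: (eqVneq r 0) => [r0|r0]; first by exists c; rewrite -r0.
by case: nex; exists I, J, r; split=> //; split=> //; exists c.
Qed.

Variable A : {mpoly F[n.+1]} -> Prop.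
Hypothesis A1 : A 1.
Hypothesis AD : forall f g, A f -> A g -> A (f + g).
Hypothesis AZ : forall c f, A f -> A (c *: f).
Hypothesis AM : forall f g, A f -> A g -> A (f * g).
Hypothesis A_divx : forall k g, A ('X_ord0 ^+ k * g) -> A g.

(** The invariant of the algorithm. Homogeneity makes division by x possible, and the last clause
    lets powers of x be cancelled in the lead monoid. *)
Definition sagbi_divx_stage B : Prop :=
  [/\ B 'X_ord0,
      forall f, B f -> f != 0 /\ exists d, f \is d.-homog,
      forall f, B f -> A f
    & forall f, B f -> f = 'X_ord0 \/ LM f ord0 = 0%N].

Lemma stage_products B p : sagbi_divx_stage B -> products B p ->
  [/\ p != 0, A p & exists d, p \is d.-homog].
Proof.
move=> [_ Bh BA _]; elim/products_ind: p / => [|f g Bf [g0 Ag [e eg]]].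
  by rewrite oner_neq0; split=> //; exists 0%N; apply: dhomog1.
have [f0 [d df]] := Bh _ Bf; split; first by rewrite mulf_neq0.
  by apply: AM => //; apply: BA.
by exists (d + e)%N; apply: dhomogM.
Qed.

(** Homogeneous polynomials with equal lead monomials have equal degrees, so both the initial
    difference and every subduction step stay in one degree. *)
Lemma stage_tete B I J f : sagbi_divx_stage B -> nontrivial_tete_a_tete B I J ->
  tete_a_tete_subducts_to B I J f -> A f /\ exists d, f \is d.-homog.
Proof.
move=> stB [[BI BJ eLM] _] [c [_ sub]].
have [I0 AI [d dI]] := stage_products stB (products_fpow BI).
have [J0 AJ [e eJ]] := stage_products stB (products_fpow BJ).
have ed : e = d by rewrite -(mdeg_LM_dhomog J0 eJ) -eLM (mdeg_LM_dhomog I0 dI).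
suff : A f /\ f \is d.-homog by case=> Af df; split=> //; exists d.
apply: (subduct_ind (P := fun f => A f /\ f \is d.-homog)) sub; last first.
  rewrite -scaleNr; split; first by apply: AD (AZ _ _).
  by rewrite rpredD ?rpredZ // -ed.
move=> a p g [Ag dg] g0 Bp p0 ep; have [_ Ap [e' e'p]] := stage_products stB Bp.
have e'd : e' = d by rewrite -(mdeg_LM_dhomog p0 e'p) ep (mdeg_LM_dhomog g0 dg).
rewrite -scaleNr; split; first by apply: AD (AZ _ _).
by rewrite rpredD ?rpredZ // -e'd.
Qed.

Lemma sagbi_divx_step_sub B B' f : sagbi_divx_step B B' -> B f -> B' f.
Proof. by case=> T [_ _ B'E] Bf; apply/B'E; left. Qed.

Lemma sagbi_divx_step_stage B B' :
  sagbi_divx_stage B -> sagbi_divx_step B B' -> sagbi_divx_stage B'.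
Proof.
move=> stB [T [T1 T2 B'E]]; have [BX Bh BA BL] := stB.
have new g : B' g -> B g \/
    [/\ g != 0, exists d, g \is d.-homog, A g & LM g ord0 = 0%N].
  case/B'E => [|[I [J [f [/T1[IJ sub] f0 fg]]]]]; [by left|right].
  have [Af [d df]] := stage_tete stB IJ sub.
  have [g0 _ gL hg] := divided_by_xP f0 df fg; split=> //.
  by apply: (A_divx (k := LM f ord0)); rewrite -fg.
split=> [|f|f|f]; first by apply/B'E; left.
- by case/new => [/Bh //|[]].
- by case/new => [/BA //|[]].
- by case/new => [/BL //|[]]; right.
Qed.

Lemma stage_neq0 B : sagbi_divx_stage B -> forall f, B f -> f != 0.
Proof. by case=> _ Bh _ _ f /Bh[]. Qed.

Lemma sagbi_divx_step_LM B B' :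
  sagbi_divx_stage B -> sagbi_divx_step B B' -> ~ all_subduct_to_zero B ->
  exists2 m, lead_monoid B' m & ~ lead_monoid B m.
Proof.
move=> stB [T [T1 T2 B'E]] /T2[I [J [f [TIJ f0]]]].
have [IJ sub] := T1 _ _ _ TIJ; have [Af [d df]] := stage_tete stB IJ sub.
have [g fg] := divided_by_x_exists f0 df.
have [g0 fL _ _] := divided_by_xP f0 df fg.
have B0 := stage_neq0 stB; have [BX _ _ _] := stB.
exists (LM g).
  by apply: lead_monoid_mem; apply/B'E; right; exists I, J, f.
move=> Bg; have [c [_ {}sub]] := sub.
have [p Bp ep] : lead_monoid B (LM f).
  rewrite fL; apply: lead_monoidD => //; apply: lead_monoidMn => //.
  by rewrite -[U_(ord0)%MM](LM_X F); apply: lead_monoid_mem.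
exact: (subducts_to_LM sub f0 Bp (products_neq0 B0 Bp)).
Qed.

(** Collecting the factors x, a product of elements of [B] becomes a power of x times a product [q]
    whose lead monomial is free of x. *)
Lemma lead_monoid_divx B m k : sagbi_divx_stage B ->
  lead_monoid B (m + U_(ord0) *+ k)%MM -> lead_monoid B m.
Proof.
move=> stB; have B0 := stage_neq0 stB; have [BX _ _ BL] := stB.
have split_x p : products B p -> p != 0 /\
    exists j q, [/\ products B q, LM q ord0 = 0%N & p = 'X_ord0 ^+ j * q].
  move=> Bp; split; first exact: products_neq0 Bp.
  elim/products_ind: p / Bp => [|f g Bf [j [q [Bq q0 ->]]]].
    by exists 0%N, 1; split; [exact: products1|rewrite LM_1 mnm0E|rewrite mulr1].
  case: (BL _ Bf) => [->|fL]; first by exists j.+1, q; rewrite mulrA -exprS.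
  exists j, (f * q); split; last by rewrite mulrCA.
    by apply: productsM => //; apply: products_mem.
  by rewrite (LM_mul (B0 _ Bf) (products_neq0 B0 Bq)) mnmDE fL q0.
case=> p /split_x[p0 [j [q [Bq q0 ep]]]] eLM.
have q_neq0 := products_neq0 B0 Bq.
have : (U_(ord0) *+ j + LM q = m + U_(ord0) *+ k)%MM.
  by rewrite -eLM ep mpolyXn LM_mul ?LM_X // mpolyX_neq0.
move/mnmP => e; have := e ord0.
rewrite !mnmDE !mulmnE !mnm1E eqxx !mul1n q0 addn0 => ej.
(* Away from x the exponents of [m] and [LM q] agree, so only the power of x has to be adjusted. *)
have -> : m = (U_(ord0) *+ m ord0 + LM q)%MM.
  apply/mnmP => i; have := e i; rewrite !mnmDE !mulmnE !mnm1E.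
  case: eqVneq => [<- _|_]; first by rewrite mul1n q0 addn0.
  by rewrite !mul0n addn0.
apply: lead_monoidD => //; last by exists q.
apply: lead_monoidMn => //; rewrite -[U_(ord0)%MM](LM_X F).
exact: lead_monoid_mem.
Qed.

Lemma sagbi_divx_run_terminates B Bs
    (h : 'I_n.+1 -> {mpoly F[n.+1]}) (d : 'I_n.+1 -> nat) :
  sagbi_divx_stage B ->
  (forall i, [/\ B (h i), (0 < d i)%N & LM (h i) = (U_(i) *+ d i)%MM]) ->
  sagbi_divx_run B Bs -> exists N, all_subduct_to_zero (Bs N).
Proof.
move=> stB hh [Bs0 step].
have st i : sagbi_divx_stage (Bs i).
  by elim: i => [|i IH]; [rewrite Bs0|apply: sagbi_divx_step_stage (step i)].
have mono i j f : (i <= j)%N -> Bs i f -> Bs j f.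
  move=> /subnK <-; elim: (j - i)%N => // k IH /IH.
  exact: sagbi_divx_step_sub (step _).
apply: NNPP => nN.
(* If the run never stopped, each stage [i] would yield a new monomial [m i]; Dickson's lemma will
   put a later one into an earlier lead monoid. *)
have /functional_choice[m mP] i : exists m, lead_monoid (Bs i.+1) m /\ ~ lead_monoid (Bs i) m.
  have [|m] := sagbi_divx_step_LM (st i) (step i); last by exists m.
  by move=> Ni; apply: nN; exists i.
have d0 i : (0 < d i)%N by have [] := hh i.
have [i [j [k [ij mij]]]] := Dickson_mod m d0.
have [_ []] := mP j; have B0 := stage_neq0 (st j).
have -> : m j = (m i + \sum_(a < n.+1) (U_(a) *+ d a) *+ k a)%MM.
  apply/mnmP => b; rewrite mij mnmDE mnm_sumE (bigD1 b) //= big1 => [|a ab].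
    by rewrite !mulmnE mnm1E eqxx mul1n addn0 mulnC.
  by rewrite !mulmnE mnm1E (negPf ab).
apply: lead_monoidD => //.
  (* [m i] is available from stage [i.+1] on, and [i < j] gives [i.+1 <= j]. *)
  have [[p Bp <-] _] := mP i; exists p => //.
  elim/products_ind: p / Bp => [|f g Bf]; first exact: products1.
  by apply: productsM; apply/products_mem/(mono i.+1).
apply: (big_ind (lead_monoid (Bs j))) => [|a b Ba Bb|a _].
- exact: lead_monoid0.
- exact: lead_monoidD.
have [Ba _ <-] := hh a; apply: lead_monoidMn => //; apply: lead_monoid_mem.
by apply: (mono 0%N) => //; rewrite Bs0.
Qed.

Lemma sagbi_divx_stage_basis B : sagbi_divx_stage B -> all_subduct_to_zero B ->
  (forall f, A f -> exists k, alg_gen B (f * 'X_ord0 ^+ k)) -> is_SAGBI_basis B A.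
Proof.
move=> stB tete loc; have B0 := stage_neq0 stB; have [_ _ BA _] := stB.
split=> // g; split.
  (* Lead monomials of elements of [A] are closed under multiplication, so the algebra they generate
     is their span. *)
  move=> Bg; apply: alg_gen_lin_span; last first.
  - apply: alg_gen_sub Bg => h [f [Bf f0 ->]].
    by exists f; split=> //; apply: BA.
  - move=> _ _ [f [Af f0 ->]] [h [Ah h0 ->]]; exists (f * h).
    by rewrite mulf_neq0 // -mpolyXD LM_mul //; split=> //; apply: AM.
  by exists 1; rewrite oner_neq0 LM_1 mpolyX0.
elim=> [|c h k [f [Af f0 ->]] _ IH]; first by rewrite -mpolyC0; exact: alg_gen_const.
apply: alg_gen_add IH; rewrite -mul_mpolyC.
apply: alg_gen_mul (alg_gen_const _ _) _; apply: lead_monoid_alg_gen => //.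
have [j Bfj] := loc _ Af; apply: (@lead_monoid_divx _ _ j stB).
have x0 : ('X_ord0 ^+ j : {mpoly F[n.+1]}) != 0 by rewrite mpolyXn mpolyX_neq0.
have := LM_alg_gen B0 tete Bfj; rewrite LM_mul // mpolyXn LM_X; apply.
by rewrite mulf_neq0 // -mpolyXn.
Qed.

Lemma sagbi_divx_correct B :
  sagbi_divx_stage B ->
  (forall i : 'I_n.+1, i != ord0 ->
     exists h a, [/\ B h, (0 < a)%N & LM h = (U_(i) *+ a)%MM]) ->
  (forall f, A f -> exists k, alg_gen B (f * 'X_ord0 ^+ k)) ->
  sagbi_divx_terminates_with_basis B A.
Proof.
move=> stB hh loc; split.
  pose Bs i := iter i divx_adjoin B; exists Bs; split=> //.
  suff st i : sagbi_divx_stage (Bs i).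
    by move=> i; apply: sagbi_divx_step_adjoin; apply: stage_neq0.
  elim: i => // i IH; apply: (sagbi_divx_step_stage IH).
  exact/sagbi_divx_step_adjoin/stage_neq0.
move=> Bs run; split.
  have [BX _ _ _] := stB.
  have /functional_choice[hd hdP] (i : 'I_n.+1) : exists hd : {mpoly F[n.+1]} * nat,
      [/\ B hd.1, (0 < hd.2)%N & LM hd.1 = (U_(i) *+ hd.2)%MM].
    case: (eqVneq i ord0) => [->|/hh[h [a hP]]]; last by exists (h, a).
    (* For the variable x, the element x itself serves, with exponent 1. *)
    by exists ('X_ord0, 1%N); rewrite LM_X mulm1n.
  exact: (@sagbi_divx_run_terminates B Bs (fun i => (hd i).1) (fun i => (hd i).2)).
move=> N tete; have [Bs0 step] := run.
(* The second half transfers the localization hypothesis from [B] to the larger set [Bs N]. *)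
have st : sagbi_divx_stage (Bs N) /\ forall f, B f -> Bs N f.
  elim: (N) => [|i [IH BBs]]; first by rewrite Bs0.
  split; first exact: sagbi_divx_step_stage (step i).
  by move=> f /BBs; apply: sagbi_divx_step_sub.
apply: sagbi_divx_stage_basis st.1 tete _ => f /loc[k Bk].
by exists k; apply: alg_gen_sub Bk; exact: st.2.
Qed.

End DivideByX.

(** * The ring of invariants as an instance of [A] *)

Section InvariantRing.
Variables (F : fieldType) (gT : finGroupType) (G : {group gT}) (n : nat).
Variables (rG : mx_representation F G n.+1) (b : 'M[F]_n.+1).
Implicit Types f g : {mpoly F[n.+1]}.
Local Notation A := (invariant_ring rG b).

Lemma invariant_ring1 : A 1.
Proof. by move=> g _; rewrite /poly_act rmorph1. Qed.

Lemma invariant_ringD f g : A f -> A g -> A (f + g).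
Proof.
move=> Af Ag s Gs; rewrite -[in RHS](Af s Gs) -[in RHS](Ag s Gs).
by rewrite /poly_act rmorphD.
Qed.

Lemma invariant_ringZ c f : A f -> A (c *: f).
Proof. by move=> Af s Gs; rewrite -[in RHS](Af s Gs) /poly_act comp_mpolyZ. Qed.

Lemma invariant_ringM f g : A f -> A g -> A (f * g).
Proof.
move=> Af Ag s Gs; rewrite -[in RHS](Af s Gs) -[in RHS](Ag s Gs).
by rewrite /poly_act rmorphM.
Qed.

(** The action is multiplicative and polynomials form a domain, so the invariant factor [f]
    cancels. *)
Lemma invariant_ring_divl f g : f != 0 -> A f -> A (f * g) -> A g.
Proof.
move=> f0 Af Afg s Gs; apply: (mulfI f0); rewrite -[RHS](Afg s Gs).
by rewrite -[in LHS](Af s Gs) /poly_act rmorphM.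
Qed.

Lemma invariant_ring_X i : b \in unitmx ->
  (forall s, s \in G -> row i b *m rG s = row i b) -> A 'X_i.
Proof.
move=> ub fix_i s Gs; rewrite /poly_act comp_mpolyXU -tnth_nth tnth_mktuple.
(* Row [i] of [b] is fixed by [rG s], so the conjugated matrix has the row [i] of [b *m invmx b]. *)
have row_i : row i (dual_action_mx rG b s) = row i 1%:M.
  by rewrite /dual_action_mx !row_mul fix_i // -row_mul mulmxV.
rewrite (bigD1 i) //= big1 => [|j ji].
  by move/rowP/(_ i): row_i; rewrite !mxE eqxx => ->; rewrite scale1r addr0.
by move/rowP/(_ j): row_i; rewrite !mxE eq_sym (negPf ji) => ->; rewrite scale0r.
Qed.

End InvariantRing.

(** * Clearing denominators, and the theorem *)

Lemma localization_clear_denominator n (F : fieldType) (S A : {mpoly F[n]} -> Prop) x f :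
  x != 0 -> (forall q, localization A x q -> localization S x q) -> A f ->
  exists k, S (f * x ^+ k).
Proof.
move=> x0 AS Af; have /AS[a [k [Sa e]]] : localization A x (tofrac f).
  by exists f, 0%N; rewrite expr0 divr1.
exists k; suff -> : f * x ^+ k = a by [].
apply/eqP; rewrite -tofrac_eq tofracM tofracXn e divfK //.
by rewrite -tofracXn tofrac_eq0 expf_neq0.
Qed.

Unset Implicit Arguments.
Set Strict Implicit.
Set Printing Implicit Defensive.

Theorem theorem2p2 (p : nat) (hp : prime p)
    (gT : finGroupType) (G : {group gT}) (hG : (p.-group G)%g)
    (F : fieldType) (hF : p \in [pchar F])
    (n : nat) (rG : mx_representation F G n.+1)
    (b : 'M[F]_n.+1) (hb : b \in unitmx)
    (hx : forall g, g \in G -> row ord0 b *m rG g = row ord0 b)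
    (hy : forall (i : 'I_n.+1) g, g \in G -> in_dual_span_le b i (row i b *m rG g))
    (fs : seq {mpoly F[n.+1]})
    (hfs : forall f, f \in fs ->
       [/\ f != 0, invariant_ring rG b f, exists d, f \is d.-homog & LM f ord0 = 0%N])
    (B : {mpoly F[n.+1]} -> Prop) (hB : B = elements_of ('X_ord0 :: fs))
    (hloc : forall q, localization (alg_gen B) 'X_ord0 q <->
                      localization (invariant_ring rG b) 'X_ord0 q)
    (hh : forall i : 'I_n.+1, i != ord0 ->
       exists h a, [/\ B h, (0 < a)%N & LM h = (U_(i) *+ a)%MM]) :
  sagbi_divx_terminates_with_basis B (invariant_ring rG b).
Proof.
have x0 : ('X_ord0 : {mpoly F[n.+1]}) != 0 by rewrite mpolyX_neq0.
have Ax := invariant_ring_X hb hx.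
apply: sagbi_divx_correct hh _.
- exact: invariant_ring1.
- exact: invariant_ringD.
- exact: invariant_ringZ.
- exact: invariant_ringM.
(* Division by x preserves invariance because x, hence each of its powers, is invariant. *)
- move=> k g; apply: invariant_ring_divl; first by rewrite expf_neq0.
  elim: k => [|k IH]; first exact: invariant_ring1.
  by rewrite exprS; apply: invariant_ringM.
- rewrite hB; split=> [|f|f|f]; rewrite /elements_of ?mem_head // inE.
  + case/predU1P => [->|/hfs[f0 _ df _]]; split=> //.
    by exists 1%N; rewrite dhomogX /= mdeg1.
  + by case/predU1P => [->|/hfs[]].
  + by case/predU1P => [->|/hfs[_ _ _ fL]]; [left|right].
- move=> f; apply: localization_clear_denominator x0 _ => q.
  by move/hloc.
Qed.
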